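(* For every $n\ge1$, the set of $DIII$ $(n,n)$-clans other than the clan ${+}\cdots{+}{-}\cdots{-}$ ($n$ plus signs followed by $n$ minus signs) is in bijection with the set of ordered pairs $(p,p')$ of minimally intersecting partitions of $[n]=\{1,\dots,n\}$ such that $p$ has exactly two blocks.
   Context: Two set partitions $p$ and $p'$ of $[n]$ are minimally intersecting if the partition whose blocks are the nonempty pairwise intersections of blocks of $p$ with blocks of $p'$ is $\{\{1\},\{2\},\dots,\{n\}\}$. An $(n,n)$-clan is a string $\gamma=c_1\cdots c_{2n}$ of symbols from $\mathbb N\cup\{+,-\}$ with equally many $+$'s and $-$'s, in which every natural number that appears appears exactly twice; two clans are equal if they have the same signs at the same positions and the same positions of matching number pairs. $rev(\gamma)=c_{2n}\cdots c_1$, and $\overline\gamma$ is obtained by exchanging $+$ and $-$. A $DIII$ $(n,n)$-clan is an $(n,n)$-clan such that (i) $\gamma=rev(\overline\gamma)$; (ii) if $c_i\in\mathbb N$ then $c_i\ne c_{2n+1-i}$; (iii) the number of $-$'s among $c_1,\dots,c_n$ plus the number of pairs $i<j\le n$ with $c_i=c_j\in\mathbb N$ is even. *)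

(* Defs.v *)
From HB Require Import structures.
From mathcomp Require Import all_boot.

Set Implicit Arguments.
Unset Strict Implicit.
Unset Printing Implicit Defensive.

Local Open Scope quotient_scope.

Variant symbol := Plus | Minus | Num of nat.

Definition symbol_code (c : symbol) : option (option nat) :=
  match c with Plus => None | Minus => Some None | Num k => Some (Some k) end.
Definition symbol_decode (o : option (option nat)) : symbol :=
  match o with None => Plus | Some None => Minus | Some (Some k) => Num k end.
Lemma symbol_codeK : cancel symbol_code symbol_decode.
Proof. by case. Qed.
HB.instance Definition _ := Countable.copy symbol (can_type symbol_codeK).

Definition is_num (c : symbol) : bool := if c is Num _ then true else false.

Definition flip (c : symbol) : symbol :=
  match c with Plus => Minus | Minus => Plus | Num k => Num k end.

(* Positions 1, ..., 2n are the ordinals 0, ..., n + n - 1; the position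
   2n + 1 - i is rev_ord i, and i belongs to the first half iff i < n. *)
Definition word (n : nat) := (n + n).-tuple symbol.

Definition is_clan (n : nat) (s : word n) : bool :=
  (count_mem Plus s == count_mem Minus s) &&
  all (fun c => is_num c ==> (count_mem c s == 2)) s.

(* Same signs at the same positions, same positions of matching numbers: the
   actual values of the numbers are irrelevant. Taking i = j in the second
   clause, the positions carrying numbers agree. *)
Definition same_clan (n : nat) (s t : word n) : bool :=
  [forall i, ((tnth s i == Plus) == (tnth t i == Plus)) &&
             ((tnth s i == Minus) == (tnth t i == Minus))] &&
  [forall i, forall j,
    (is_num (tnth s i) && (tnth s i == tnth s j)) ==
    (is_num (tnth t i) && (tnth t i == tnth t j))].

Definition rev_word (n : nat) (s : word n) : word n := [tuple of rev s].
Definition flip_word (n : nat) (s : word n) : word n := [tuple of map flip s].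

Definition num_minus_half (n : nat) (s : word n) : nat :=
  #|[set i : 'I_(n + n) | (i < n) && (tnth s i == Minus)]|.

Definition num_pairs_half (n : nat) (s : word n) : nat :=
  #|[set ij : 'I_(n + n) * 'I_(n + n) |
      [&& ij.1 < ij.2, ij.2 < n, is_num (tnth s ij.1)
        & tnth s ij.1 == tnth s ij.2]]|.

Definition is_DIII (n : nat) (s : word n) : bool :=
  [&& same_clan s (rev_word (flip_word s)),
      [forall i, is_num (tnth s i) ==> (tnth s i != tnth s (rev_ord i))]
    & ~~ odd (num_minus_half s + num_pairs_half s)].

Lemma same_clanP (n : nat) (s t : word n) :
  reflect [/\ forall i, (tnth s i == Plus) = (tnth t i == Plus),
              forall i, (tnth s i == Minus) = (tnth t i == Minus)
            & forall i j, (is_num (tnth s i) && (tnth s i == tnth s j)) =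
                          (is_num (tnth t i) && (tnth t i == tnth t j))]
          (same_clan s t).
Proof.
apply: (iffP andP) => [[/forallP h1 /forallP h2]|[h1 h2 h3]]; split.
- by move=> i; case/andP: (h1 i) => /eqP.
- by move=> i; case/andP: (h1 i) => _ /eqP.
- by move=> i j; apply/eqP; apply: (forallP (h2 i)).
- by apply/forallP => i; rewrite h1 h2 !eqxx.
- by apply/forallP => i; apply/forallP => j; rewrite h3.
Qed.

Lemma same_clan_refl (n : nat) : reflexive (@same_clan n).
Proof. by move=> s; apply/same_clanP. Qed.

Lemma same_clan_sym (n : nat) : symmetric (@same_clan n).
Proof.
by move=> s t; apply/same_clanP/same_clanP => -[h1 h2 h3]; split=> *;
   rewrite ?h1 ?h2 ?h3.
Qed.

Lemma same_clan_trans (n : nat) : transitive (@same_clan n).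
Proof.
move=> t s u /same_clanP[h1 h2 h3] /same_clanP[g1 g2 g3].
by apply/same_clanP; split=> *; rewrite ?h1 ?h2 ?h3.
Qed.

Lemma tnth_rev_flip (n : nat) (s : word n) i :
  tnth (rev_word (flip_word s)) i = flip (tnth s (rev_ord i)).
Proof.
rewrite (tnth_nth Plus) /= nth_rev ?size_map ?size_tuple //.
rewrite (nth_map Plus) ?size_tuple; last exact: (ltn_ord (rev_ord i)).
by rewrite (tnth_nth Plus).
Qed.

Lemma same_clan_rev_flip (n : nat) (s t : word n) : same_clan s t ->
  same_clan (rev_word (flip_word s)) (rev_word (flip_word t)).
Proof.
have fP c : (flip c == Plus) = (c == Minus) by case: c.
have fM c : (flip c == Minus) = (c == Plus) by case: c.
have fN c d : is_num (flip c) && (flip c == flip d) = is_num c && (c == d).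
  by case: c; case: d.
move=> /same_clanP[h1 h2 h3]; apply/same_clanP; split=> *;
  by rewrite !tnth_rev_flip ?fP ?fM ?fN ?h1 ?h2 ?h3.
Qed.

Lemma is_DIII_same (n : nat) (s t : word n) :
  same_clan s t -> is_DIII s = is_DIII t.
Proof.
move=> st; have rst := same_clan_rev_flip st.
have /same_clanP[_ h2 h3] := st.
congr [&& _, _ & ~~ odd (_ + _)].
- apply/idP/idP => h; last first.
    by rewrite same_clan_sym in rst; exact: same_clan_trans (same_clan_trans st h) rst.
  rewrite same_clan_sym in st.
  exact: same_clan_trans (same_clan_trans st h) rst.
- apply: eq_forallb => i; move: (h3 i (rev_ord i)).
  have := h3 i i; rewrite !eqxx !andbT => ->.
  by case: (is_num _) => //= ->.
- by apply: eq_card => i; rewrite !inE h2.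
- by apply: eq_card => -[i j]; rewrite !inE /= h3.
Qed.

Definition clan_word (n : nat) := {s : word n | is_clan s}.

Definition clan_equiv (n : nat) : rel (clan_word n) :=
  fun u v => same_clan (val u) (val v).

Lemma clan_equiv_refl (n : nat) : reflexive (@clan_equiv n).
Proof. by move=> u; apply: same_clan_refl. Qed.
Lemma clan_equiv_sym (n : nat) : symmetric (@clan_equiv n).
Proof. by move=> u v; apply: same_clan_sym. Qed.
Lemma clan_equiv_trans (n : nat) : transitive (@clan_equiv n).
Proof. by move=> v u w; apply: same_clan_trans. Qed.

Canonical clan_equivRel (n : nat) :=
  EquivRel (@clan_equiv n) (@clan_equiv_refl n) (@clan_equiv_sym n)
    (@clan_equiv_trans n).

Definition clan (n : nat) := {eq_quot @clan_equiv n}.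
HB.instance Definition _ n := EqQuotient.on (clan n).

(* Independent of the representative: see DIII_pi. *)
Definition DIII (n : nat) (c : clan n) : bool := is_DIII (val (repr c)).

Lemma DIII_pi (n : nat) (u : clan_word n) :
  DIII (\pi_(clan n) u) = is_DIII (val u).
Proof.
apply: is_DIII_same; have /eqmodP : repr (\pi_(clan n) u) = u %[mod clan n].
  by rewrite reprK.
by [].
Qed.

Definition plus_minus_word (n : nat) : word n :=
  [tuple of nseq n Plus ++ nseq n Minus].

Lemma plus_minus_is_clan (n : nat) : is_clan (plus_minus_word n).
Proof.
rewrite /is_clan /= !count_cat !count_nseq /= !mul0n !mul1n addn0 add0n eqxx.
by rewrite all_cat !all_nseq /= !orbT.
Qed.

Definition plus_minus_clan (n : nat) : clan n :=
  \pi_(clan n) (exist _ (plus_minus_word n) (plus_minus_is_clan n) : clan_word n).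

Definition set_partition (n : nat) (p : {set {set 'I_n}}) : bool :=
  partition p [set: 'I_n].

Definition minimally_intersecting (n : nat) (p p' : {set {set 'I_n}}) : bool :=
  [set B :&: B' | B in p, B' in p'] :\ set0 == [set [set i] | i : 'I_n].

Definition admissible_pair (n : nat)
    (pp : {set {set 'I_n}} * {set {set 'I_n}}) : bool :=
  [&& set_partition pp.1, set_partition pp.2,
      minimally_intersecting pp.1 pp.2 & #|pp.1| == 2].

(* Main.v *)
(** Both sets are parametrised by an involution s of [n] together with one bit
for each orbit of s. A DIII clan is determined by its first half: s matches i
with j when c_i is matched with c_j or with its mirror image; the bit tells
these two cases apart, and for a fixed point of s it is the sign. Condition
(iii) says that the sum of the bits is even, and the excluded clan is s = id
with all bits 0.
A partition p' occurring in an admissible pair has blocks of size at most 2, as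
they meet each of the two blocks of p at most once, so p' is the set of orbits
of s, and p is a 2-colouring, up to exchange of the colours, in which s changes
the colour of every point it moves. Colouring the least element of each orbit
and requiring the colour of 1 to vanish leaves one free bit for each orbit but
that of 1; the missing bit is restored by parity. *)

Require Import Defs.
From HB Require Import structures.
From mathcomp Require Import all_boot.

Set Implicit Arguments.
Unset Strict Implicit.
Unset Printing Implicit Defensive.

(** Both bijections below are given as relations; [xchoose] picks the images, so no inverse has to
    be written down as a function. *)
Lemma bijective_of_rel (A B : choiceType) (rel : A -> B -> bool) :
  (forall a, exists b, rel a b) -> (forall b, exists a, rel a b) ->
  (forall a b b', rel a b -> rel a b' -> b = b') ->
  (forall a a' b, rel a b -> rel a' b -> a = a') ->
  exists f : A -> B, bijective f.
Proof.
move=> totA totB funA funB; exists (fun a => xchoose (totA a)).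
exists (fun b => xchoose (totB b)) => [a|b].
  exact: funB (xchooseP (totB _)) (xchooseP (totA a)).
exact: funA (xchooseP (totA _)) (xchooseP (totB b)).
Qed.

(** * Involutions with orbit bits, and coordinates for positions *)

Section Data.
Variable n : nat.
Implicit Types (i j k : 'I_n) (d e : bool).

(** Bits are stored at points, not at orbits; the second clause of [symmetric_data] makes them
    constant on orbits. *)
Definition data := ({ffun 'I_n -> 'I_n} * {ffun 'I_n -> bool})%type.
Implicit Types (x y : data) (s t : word n).

Definition data0 : data := ([ffun i => i], [ffun=> false]).

Definition symmetric_data x :=
  [forall i, x.1 (x.1 i) == i] && [forall i, x.2 (x.1 i) == x.2 i].

(** For symmetric data, [i <= x.1 i] selects the least element of each orbit, so every orbit bit is
    counted once. *)
Definition weight x := #|[set i : 'I_n | (i <= x.1 i) && x.2 i]|.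

Definition even_data x := symmetric_data x && ~~ odd (weight x).

Lemma symmetric_dataP x :
  reflect (involutive x.1 /\ forall i, x.2 (x.1 i) = x.2 i) (symmetric_data x).
Proof.
apply: (iffP andP) => -[h1 h2]; split.
- by move=> i; apply/eqP/(forallP h1).
- by move=> i; apply/eqP/(forallP h2).
- by apply/forallP => i; rewrite h1.
- by apply/forallP => i; rewrite h2.
Qed.

Lemma data0_symmetric : symmetric_data data0.
Proof. by apply/symmetric_dataP; split=> i /=; rewrite !ffunE. Qed.

Lemma data0_even : even_data data0.
Proof.
rewrite /even_data data0_symmetric /weight eq_card0 // => i.
by rewrite !inE /= !ffunE andbF.
Qed.

Definition orbit_min x i := if i <= x.1 i then i else x.1 i.

Lemma orbit_min_eq x i j : involutive x.1 ->
  (orbit_min x i == orbit_min x j) = (j == i) || (j == x.1 i).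
Proof.
move=> inv; have invE k l : (x.1 k == l) = (k == x.1 l).
  by apply/eqP/eqP => [<-|->]; rewrite inv.
rewrite /orbit_min; apply/eqP/orP.
  case: ifP => _; case: ifP => _.
  - by move=> ->; left.
  - by move=> ->; rewrite inv; right.
  - by move=> ->; right.
  - by move/(can_inj inv)=> ->; left.
case=> /eqP-> //; rewrite inv.
by case: ltngtP => // /val_inj.
Qed.

(* The position of i in the half d of the word, so that the mirror image of
   pos d i is pos (~~ d) i. *)
Definition pos d i : 'I_(n + n) :=
  if d then rev_ord (lshift n i) else lshift n i.

Lemma rev_pos d i : rev_ord (pos d i) = pos (~~ d) i.
Proof. by case: d => //=; rewrite rev_ordK. Qed.

Lemma pos_lt d i : (pos d i < n) = ~~ d.
Proof.
case: d => /=; last exact: ltn_ord.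
by rewrite -addnBA ?(ltn_ord i) // ltnNge leq_addr.
Qed.

Lemma posP z : exists d i, z = pos d i.
Proof.
case: (split_ordP z) => i ->; first by exists false, i.
(* In the second half, [rshift n i] is the mirror image of [lshift n (rev_ord i)]. *)
exists true, (rev_ord i); apply: val_inj => /=.
by have := ltn_ord i; rewrite subnSK // => lt_in; rewrite -addnBA ?leq_subr ?subKn // ltnW.
Qed.

Lemma pos_inj d d' i j : pos d i = pos d' j -> d = d' /\ i = j.
Proof.
move=> eq_pos; have eq_d : d = d'.
  by apply: negb_inj; rewrite -(pos_lt d i) -(pos_lt d' j) eq_pos.
split=> //; move: eq_pos; rewrite -{}eq_d; case: d => [/rev_ord_inj|] ;
  exact: lshift_inj.
Qed.

Lemma pos_eq d d' i j : (pos d i == pos d' j) = (d == d') && (i == j).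
Proof.
by apply/eqP/andP => [/pos_inj[-> ->]|[/eqP-> /eqP->]].
Qed.

(** * Words modelled by data, up to equality of clans *)

Definition sign d := if d then Minus else Plus.

Lemma sign_Plus d : (sign d == Plus) = ~~ d. Proof. by case: d. Qed.
Lemma sign_Minus d : (sign d == Minus) = d. Proof. by case: d. Qed.

(* In a symmetric clan, a fixed point i of x.1 carries the sign x.2 i, and
   x.2 i tells whether a pair {i, x.1 i} is matched inside the first half or
   across the middle. *)
Definition models s x :=
  [forall d, forall i, if x.1 i == i then tnth s (pos d i) == sign (x.2 i (+) d)
   else is_num (tnth s (pos d i)) &&
    [forall d', forall j, (tnth s (pos d i) == tnth s (pos d' j)) ==
      ((j == i) && (d' == d)) || ((j == x.1 i) && (d' == d (+) ~~ x.2 i))]].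

Lemma modelsP s x :
  reflect ((forall d i, x.1 i = i -> tnth s (pos d i) = sign (x.2 i (+) d)) /\
    (forall d i, x.1 i <> i -> is_num (tnth s (pos d i)) /\
      forall d' j, (tnth s (pos d i) == tnth s (pos d' j)) =
      ((j == i) && (d' == d)) || ((j == x.1 i) && (d' == d (+) ~~ x.2 i))))
   (models s x).
Proof.
apply: (iffP forallP) => [h|[h1 h2] d].
  split=> d i; have := forallP (h d) i.
    by case: eqP => // _ /eqP.
  case: eqP => // _ /andP[-> /forallP h'] _; split=> // d' j.
  by have /forallP/(_ j)/eqP := h' d'.
apply/forallP=> i; case: eqP => [/(h1 d)-> //|/(h2 d)[-> h]].
by apply/forallP => d'; apply/forallP => j; rewrite h.
Qed.

Lemma models_is_num s x d i : models s x ->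
  is_num (tnth s (pos d i)) = (x.1 i != i).
Proof.
case/modelsP=> h1 h2; case: eqP => [/(h1 d)->|/(h2 d)[]//].
by case: (_ (+) _).
Qed.

(** The data prescribe every sign and the whole matching relation; only the values of the numbers
    stay free. *)
Lemma models_same_clan s t x : models s x -> models t x -> same_clan s t.
Proof.
move=> ms mt; apply/same_clanP.
have [s1 s2] := modelsP _ _ ms; have [t1 t2] := modelsP _ _ mt.
have eq_sign d i c : ~~ is_num c ->
    (tnth s (pos d i) == c) = (tnth t (pos d i) == c).
  case: (eqVneq (x.1 i) i) => [eq_i|/eqP ne_i] nc; first by rewrite s1 ?t1.
  have [[ns _] [nt _]] := (s2 d i ne_i, t2 d i ne_i).
  by case: c (tnth _ _) (tnth _ _) ns nt nc => [||?] [||?] [||?].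
split=> [z|z|z w].
- by have [d [i ->]] := posP z; apply: eq_sign.
- by have [d [i ->]] := posP z; apply: eq_sign.
have [d [i ->]] := posP z; have [d' [j ->]] := posP w.
rewrite !(models_is_num _ _ ms, models_is_num _ _ mt).
case: eqP => //= ne_i.
by have [[_ ->] [_ ->]] := (s2 d i ne_i, t2 d i ne_i).
Qed.

Lemma same_clan_transfer s t x : same_clan s t -> models s x -> models t x.
Proof.
move=> /same_clanP[hP hM hN] /modelsP[s1 s2].
have numE z : is_num (tnth s z) = is_num (tnth t z).
  by have := hN z z; rewrite !eqxx !andbT.
apply/modelsP; split=> d i.
  move=> ei; have := hP (pos d i); have := hM (pos d i); rewrite s1 //.
  by case: (_ (+) _) => /= /esym/eqP + /esym/eqP.
move=> ni; have [ns hs] := s2 d i ni; split=> [|d' j]; first by rewrite -numE.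
by have := hN (pos d i) (pos d' j); rewrite -numE ns hs.
Qed.

(** The first half suffices: numbers mark the moved points, [Minus] gives the bit of a fixed point,
    and the partner of [pos false i] gives both components at a moved point. *)
Lemma same_clan_models s t x y :
  same_clan s t -> models s x -> models t y -> x = y.
Proof.
move=> /same_clanP[_ hM hN] ms mt.
have [s1 s2] := modelsP _ _ ms; have [t1 t2] := modelsP _ _ mt.
have eq_fix i : (x.1 i != i) = (y.1 i != i).
  rewrite -(models_is_num false i ms) -(models_is_num false i mt).
  by have := hN (pos false i) (pos false i); rewrite !eqxx !andbT.
have eq_xy i : x.1 i = y.1 i /\ x.2 i = y.2 i.
  have := eq_fix i; case: (eqVneq (x.1 i) i) => [xi|/eqP xi].
    case: (eqVneq (y.1 i) i) => // yi _; rewrite xi yi; split=> //.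
    have := hM (pos false i); rewrite s1 // t1 // !sign_Minus.
    by rewrite !addbF.
  case: eqP => // yi _.
  have [[ns es] [nt et]] := (s2 false i xi, t2 false i yi).
  (* The probe is the partner that [x] predicts in [s]; in [t] it must be the one that [y]
     predicts. *)
  have := hN (pos false i) (pos (~~ x.2 i) (x.1 i)).
  rewrite ns nt es et /= !eqxx orbT /= => /esym/orP[/andP[/eqP]//|].
  by case/andP=> /eqP-> /eqP/negb_inj->.
case: x y eq_xy {ms mt s1 s2 t1 t2 eq_fix} => [x1 x2] [y1 y2] /= eq_xy.
by congr (_, _); apply/ffunP => i; case: (eq_xy i).
Qed.

(** * Clan conditions on modelled words, and a word for each symmetric datum *)

Lemma count_mem_tnth s c : count_mem c s = #|[set z | tnth s z == c]|.
Proof.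
rewrite -{1}(map_tnth_enum s) count_map enumT cardE /enum_mem size_filter.
by apply: eq_count => z; rewrite !inE.
Qed.

Lemma is_clanP s :
  reflect (#|[set z | tnth s z == Plus]| = #|[set z | tnth s z == Minus]| /\
    forall z, is_num (tnth s z) -> #|[set w | tnth s w == tnth s z]| = 2)
  (is_clan s).
Proof.
rewrite /is_clan !count_mem_tnth; apply: (iffP andP) => -[h1 h2]; split.
- exact/eqP.
- move=> z nz; rewrite -count_mem_tnth; apply/eqP.
  by move/all_tnthP/(_ z)/implyP: h2; apply.
- exact/eqP.
- by apply/all_tnthP => z; apply/implyP => /h2; rewrite count_mem_tnth => ->.
Qed.

(** Reflection exchanges the positions of the two signs, and a number sits at [pos d i] and its
    partner, which differ because [x.1 i] differs from [i]. *)
Lemma models_is_clan s x : models s x -> is_clan s.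
Proof.
move=> ms; have [s1 s2] := modelsP _ _ ms; apply/is_clanP; split.
  rewrite -(card_imset _ rev_ord_inj); apply: eq_card => z.
  rewrite -[z]rev_ordK mem_imset ?inE; last exact: rev_ord_inj.
  have [d [i ->]] := posP z; rewrite !rev_pos negbK.
  case: (eqVneq (x.1 i) i) => [ei|/eqP ni].
    by rewrite !s1 // sign_Plus sign_Minus addbN negbK.
  have [[n1 _] [n2 _]] := (s2 d i ni, s2 (~~ d) i ni).
  by case: (tnth s (pos d i)) n1 => // ? _; case: (tnth s (pos (~~ d) i)) n2.
move=> z; have [d [i ->]] := posP z; rewrite (models_is_num _ _ ms) => /eqP ni.
have [_ hi] := s2 d i ni.
rewrite -[RHS](_ : #|[set pos d i; pos (d (+) ~~ x.2 i) (x.1 i)]| = 2).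
  apply: eq_card => w; have [d' [j ->]] := posP w.
  by rewrite !inE !pos_eq eq_sym hi ![(j == _) && _]andbC.
rewrite cards2 pos_eq [i == _]eq_sym; move/eqP/negbTE: ni => ->.
by rewrite andbF.
Qed.

(** The orbits with bit 1 are of two kinds: fixed points, which carry the minus signs of the first
    half ([F]), and pairs matched inside the first half, recorded by their smaller end ([G]). *)
Lemma models_weight s x : symmetric_data x -> models s x ->
  num_minus_half s + num_pairs_half s = weight x.
Proof.
case/symmetric_dataP=> inv x2 ms; have [s1 s2] := modelsP _ _ ms.
pose F := [set i : 'I_n | (x.1 i == i) && x.2 i].
pose G := [set i : 'I_n | (i < x.1 i) && x.2 i].
have ->: num_minus_half s = #|F|.
  rewrite -(card_imset (mem F) (@lshift_inj n n)); apply: eq_card => z.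
  have [d [i ->]] := posP z; rewrite inE pos_lt.
  case: d => /=.
    apply/esym/negbTE/imsetP => -[j _].
    by move/(congr1 (fun u : 'I__ => u < n)); rewrite (pos_lt true i) (pos_lt false j).
  rewrite mem_imset ?inE; last exact: lshift_inj.
  have /= := models_is_num false i ms; have /= := s1 false i.
  case: eqP => [ei -> // _|_ _]; first by rewrite addbF sign_Minus.
  by case: (tnth s (lshift n i)).
have ->: num_pairs_half s = #|G|.
  pose h i := (pos false i, pos false (x.1 i)).
  have h_inj : injective h by move=> i j /(congr1 fst)/lshift_inj.
  rewrite -(card_imset (mem G) h_inj); apply: eq_card => -[z w].
  have [d [i ->]] := posP z; have [d' [j ->]] := posP w.
  rewrite inE /= pos_lt; apply/idP/imsetP.
    (* Both ends lie in the first half, so [d] and [d'] are false, and the match then forces the bit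
       to be 1. *)
    case/and4P=> lt_ij; case: d' lt_ij => // lt_ij _.
    have := ltn_trans lt_ij (ltn_ord _ : lshift n j < _).
    have : pos d i < n by apply: ltn_trans lt_ij _; rewrite pos_lt.
    rewrite pos_lt; case: d lt_ij => //= lt_ij _ _.
    rewrite (models_is_num false i ms) => /eqP ni.
    have [_ hi] := s2 false i ni.
    move/(_ false j): hi => /= -> /orP[/andP[/eqP eq_ji _]|].
      by move: lt_ij; rewrite eq_ji ltnn.
    case/andP=> /eqP ej; case bi: (x.2 i) => // _.
    by exists i; rewrite ?inE ?bi ?andbT -?ej // /h -ej.
  case=> k; rewrite inE => /andP[lt_k bk] [].
  move/(pos_inj (d' := false)) => [-> ->] /(pos_inj (d' := false))[-> ->].
  rewrite /= lt_k (models_is_num false k ms).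
  have nk : x.1 k <> k by move=> ek; rewrite ek ltnn in lt_k.
  rewrite (introN eqP nk) /=; have [_ hk] := s2 false k nk.
  by rewrite -[lshift n k]/(pos false k) -[lshift n _]/(pos false (x.1 k)) hk bk !eqxx orbT.
rewrite /weight -(cardsID [set i : 'I_n | x.1 i == i] [set i : 'I_n | _]).
congr (_ + _); apply: eq_card => i; rewrite !inE.
  by rewrite andbC; case: eqP => [->|_]; rewrite ?leqnn ?andbT ?andbF.
by rewrite ltn_neqAle eq_sym andbA.
Qed.

(** [flip] swaps the signs and respects matching, so condition (i) can be stated with [rev_ord]
    alone; the clause for [Minus] is the one for [Plus] at the mirror position. *)
Lemma skew_words s :
  same_clan s (rev_word (flip_word s)) <->
  [/\ forall z, (tnth s z == Plus) = (tnth s (rev_ord z) == Minus) &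
      forall z w, (is_num (tnth s z) && (tnth s z == tnth s w)) =
        (is_num (tnth s (rev_ord z)) && (tnth s (rev_ord z) == tnth s (rev_ord w)))].
Proof.
have fP c : (flip c == Plus) = (c == Minus) by case: c.
have fM c : (flip c == Minus) = (c == Plus) by case: c.
have fN c c' : is_num (flip c) && (flip c == flip c') = is_num c && (c == c').
  by case: c; case: c'.
split=> [/same_clanP[h1 _ h3]|[h1 h3]].
  split=> [z|z w]; first by rewrite h1 tnth_rev_flip fP.
  by rewrite h3 !tnth_rev_flip fN.
apply/same_clanP; split=> [z|z|z w]; rewrite !tnth_rev_flip ?fP ?fM ?fN //.
by rewrite h1 rev_ordK.
Qed.

(** Conditions (i) and (ii) hold for every modelled word: complementing both halves preserves the
    matching rule, and a partner has a different index, hence is not the mirror image. Only parity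
    remains. *)
Lemma models_is_DIII s x : symmetric_data x -> models s x ->
  is_DIII s = even_data x.
Proof.
move=> sx ms; rewrite /is_DIII /even_data (models_weight sx ms) sx.
have [s1 s2] := modelsP _ _ ms.
have -> : same_clan s (rev_word (flip_word s)).
  apply/skew_words; split=> [z|z w].
    have [d [i ->]] := posP z; rewrite rev_pos.
    case: (eqVneq (x.1 i) i) => [ei|/eqP ni].
      by rewrite !s1 // sign_Plus sign_Minus addbN.
    have [[n1 _] [n2 _]] := (s2 d i ni, s2 (~~ d) i ni).
    by case: (tnth s (pos d i)) n1 => // ? _; case: (tnth s (pos (~~ d) i)) n2.
  have [d [i ->]] := posP z; have [d' [j ->]] := posP w.
  rewrite !rev_pos !(models_is_num _ _ ms); case: eqP => //= ni.
  have [[_ ->] [_ ->]] := (s2 d i ni, s2 (~~ d) i ni).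
  by case: d {s1 s2}; case: d'; case: (x.2 i).
have -> // : [forall z, is_num (tnth s z) ==> (tnth s z != tnth s (rev_ord z))].
apply/forallP => z; have [d [i ->]] := posP z; rewrite rev_pos.
rewrite (models_is_num _ _ ms); apply/implyP => ni.
have [_ ->] := s2 d i (elimN eqP ni).
by rewrite eqxx [i == _]eq_sym (negbTE ni) orbF; case: d.
Qed.

(* The last bit of the label separates the two pairs that are mirror images of
   each other. *)
Definition data_symbol x d i : symbol :=
  if x.1 i == i then sign (x.2 i (+) d)
  else Defs.Num ((~~ x.2 i && (x.1 i < i)) (+) d + (orbit_min x i).*2).

Definition data_word x : word n :=
  [tuple match split z with
         | inl i => data_symbol x false i
         | inr i => data_symbol x true (rev_ord i)
         end | z < n + n].

Lemma tnth_data_word x d i : tnth (data_word x) (pos d i) = data_symbol x d i.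
Proof.
rewrite tnth_mktuple; case: d; last by rewrite (unsplitK (inl _ i)).
have -> : pos true i = rshift n (rev_ord i).
  apply: val_inj => /=; rewrite addnBA //.
by rewrite (unsplitK (inr _ _)) rev_ordK.
Qed.

(** [orbit_min] identifies the orbit. For bit 1 the last bit of the label is the half; for bit 0 it
    is complemented at the larger end, so that ends in opposite halves agree. *)
Lemma data_word_models x : symmetric_data x -> models (data_word x) x.
Proof.
case/symmetric_dataP=> inv x2; apply/modelsP; split=> d i.
  by move=> ei; rewrite tnth_data_word /data_symbol ei eqxx.
move=> /eqP ni; rewrite tnth_data_word /data_symbol (negbTE ni); split=> // d' j.
rewrite tnth_data_word /data_symbol.
have lt_i : (i < x.1 i) = ~~ (x.1 i < i).
  by rewrite -leqNgt ltn_neqAle eq_sym (ni : x.1 i != i :> nat).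
case: (eqVneq (x.1 j) j) => [ej|nj].
  have -> : (j == i) = false.
    by apply/eqP => ji; rewrite ji in ej; rewrite ej eqxx in ni.
  have -> : (j == x.1 i) = false.
    by apply/eqP => ji; move: ni; rewrite -ji -[i]inv -ji ej eqxx.
  by case: (x.2 j (+) d').
have eq_label (a b : bool) (k l : 'I_n) :
    (Defs.Num (a + k.*2) == Defs.Num (b + l.*2)) = (a == b) && (k == l).
  apply/eqP/andP => [[eq_kl]|[/eqP-> /eqP->] //].
  have ab : a = b.
    by move/(congr1 odd): eq_kl; rewrite !oddD !odd_double !addbF !oddb.
  split; first exact/eqP.
  by move: eq_kl; rewrite ab => /addnI/double_inj/val_inj->.
rewrite eq_label orbit_min_eq //.
case: (eqVneq j i) => [->|nji] /=.
  by rewrite [i == _]eq_sym (negbTE ni) /= orbF andbT; case: d; case: d'; case: (_ && _).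
case: (eqVneq j (x.1 i)) => [->|_] /=; last by rewrite andbF.
rewrite x2 inv lt_i andbT.
by case: d; case: d'; case: (x.2 i); case: (x.1 i < i).
Qed.

Lemma plus_minus_models : models (plus_minus_word n) data0.
Proof.
apply/modelsP; split=> d i /=; rewrite !ffunE // => _.
rewrite (tnth_nth Plus) /= nth_cat size_nseq pos_lt !nth_nseq.
case: d => /=; last by rewrite ltn_ord.
rewrite ltn_subLR ?ltn_ord //; last by rewrite -addnBA ?leq_addr.
by rewrite ltn_subrL addn_gt0 (leq_trans _ (ltn_ord i)).
Qed.

(** * The data of a DIII clan *)

(** The data are read off the first half, and (i) carries the description over to the second. By
    (ii) a number never gives a fixed point; symmetry of the matching makes the data symmetric. *)
Lemma DIII_models s : is_clan s -> is_DIII s ->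
  exists2 x, even_data x & models s x.
Proof.
move=> /is_clanP[_ s2] Ds.
have /and3P[/skew_words[hP hN] /forallP hC _] := Ds.
have numR z : is_num (tnth s (rev_ord z)) = is_num (tnth s z).
  by have := hN z z; rewrite !eqxx !andbT.
pose spec i (u : 'I_n * bool) := if is_num (tnth s (pos false i)) then
    u.1 != i /\ forall d' j, (tnth s (pos false i) == tnth s (pos d' j)) =
      ((j == i) && (d' == false)) || ((j == u.1) && (d' == ~~ u.2))
  else u.1 = i /\ tnth s (pos false i) = sign u.2.
have [f Hf] : exists f : 'I_n -> 'I_n * bool, forall i, spec i (f i).
  apply: fin_all_exists => i; rewrite /spec.
  case ni: (is_num _); last first.
    exists (i, tnth s (pos false i) == Minus); split=> //=.
    by case: (tnth s (lshift n i)) ni.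
  have /eqP/cards2P[u [v [neq_uv eq_uv]]] := s2 _ ni.
  have [w neq_w eq_w] : exists2 w, pos false i != w &
      forall z, (tnth s (pos false i) == tnth s z) = (z == pos false i) || (z == w).
    have memE z : (tnth s z == tnth s (pos false i)) = (z == u) || (z == v).
      by move/setP/(_ z): eq_uv; rewrite !inE.
    have := memE (pos false i); rewrite eqxx => /esym/orP[] /eqP ei.
      by exists v => [|z]; rewrite ei // eq_sym -ei memE ei.
    by exists u => [|z]; rewrite ei 1?eq_sym // -ei memE ei orbC.
  (* A partner in the first half ([d] false) means bit 1, hence the bit [~~ d]. If [j] were [i],
     then [w] would be the position itself or its mirror image, which (ii) forbids. *)
  have [d [j wE]] := posP w; exists (j, ~~ d) => /=; split.
    apply/eqP => ji; move: (hC (pos false i)); rewrite ni rev_pos eq_w wE ji.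
    move: neq_w; rewrite wE ji !pos_eq eqxx.
    by case: d {wE}.
  by move=> d' k; rewrite eq_w wE !pos_eq negbK ![(k == _) && _]andbC.
pose x : data := ([ffun i => (f i).1], [ffun i => (f i).2]).
have fix_num i : is_num (tnth s (pos false i)) = (x.1 i != i).
  rewrite ffunE; have := Hf i; rewrite /spec; case: ifP => _ [] //.
  by move=> ->; rewrite eqxx.
have mx : models s x.
  apply/modelsP; split=> d i.
    move=> ei; have := Hf i; rewrite /spec fix_num ei eqxx /= ffunE => -[_ eq_s].
    case: d; last by rewrite eq_s addbF.
    have := hP (pos false i); have := hP (pos true i); rewrite !rev_pos eq_s /=.
    have := numR (pos false i); rewrite rev_pos fix_num ei eqxx /=.
    rewrite sign_Minus sign_Plus.
    by case: (tnth s (rev_ord (lshift n i))) => //; case: (f i).2.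
  move/eqP=> ni; have := Hf i; rewrite /spec fix_num ni => -[_].
  have xi1 : (f i).1 = x.1 i by rewrite ffunE.
  have xi2 : (f i).2 = x.2 i by rewrite ffunE.
  rewrite xi1 xi2 => hi; case: d; last by rewrite fix_num ni.
  have nR : is_num (tnth s (pos true i)).
    by rewrite -(rev_pos false) numR fix_num ni.
  split=> // d' j; have := hN (pos true i) (pos d' j).
  rewrite nR !rev_pos fix_num ni hi /= => ->.
  by case: d'; case: (x.2 i).
have [s1 s2'] := modelsP _ _ mx.
(* Seen from the partner of [i], its own partner is [pos false i]; comparing index and half gives
   the two equations. *)
have back i : x.1 i != i -> x.1 (x.1 i) = i /\ x.2 (x.1 i) = x.2 i.
  move=> /eqP ni; have [ni' hi] := s2' false i ni.
  have /eqP eq_s : tnth s (pos false i) == tnth s (pos (~~ x.2 i) (x.1 i)).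
    by rewrite hi !eqxx orbT.
  have nxi : x.1 (x.1 i) != x.1 i.
    by rewrite -(models_is_num (~~ x.2 i) _ mx) -eq_s.
  have [_ hxi] := s2' (~~ x.2 i) _ (elimN eqP nxi).
  move/eqP: eq_s; rewrite eq_sym hxi [i == x.1 i]eq_sym (introF eqP ni) /=.
  case/andP=> /eqP <-; split=> //.
  by case: (x.2 i) (x.2 (x.1 i)) b => [] [].
have sx : symmetric_data x.
  apply/symmetric_dataP; split=> i; case: (eqVneq (x.1 i) i) => [ei|/back[] //];
  by rewrite !ei.
by exists x; rewrite // -(models_is_DIII sx mx).
Qed.

End Data.

(** * Set partitions through block membership *)

Lemma set_partition_ext n (p q : {set {set 'I_n}}) :
  set_partition p -> set_partition q ->
  (forall i j, (j \in pblock p i) = (j \in pblock q i)) -> p = q.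
Proof.
move=> hp hq eq_pq; rewrite -(equivalence_partition_pblock hp).
rewrite -(equivalence_partition_pblock hq).
by apply: eq_imset => i; apply/setP => j; rewrite !inE eq_pq.
Qed.

Lemma mem_pblockT n (p : {set {set 'I_n}}) i :
  set_partition p -> pblock p i \in p /\ i \in pblock p i.
Proof.
move=> hp; have Pi : i \in cover p by rewrite (cover_partition hp) inE.
by rewrite pblock_mem // mem_pblock.
Qed.

Lemma pblock_preim n (T : eqType) (f : 'I_n -> T) i j :
  (j \in pblock (preim_partition f [set: 'I_n]) i) = (f i == f j).
Proof.
rewrite pblock_equivalence_partition ?inE //.
by move=> a b c _ _ _; split=> // /eqP->.
Qed.

(** A nonempty intersection of blocks that contains [i] is [pblock p i :&: pblock p' i], so the
    condition says that each of these is the singleton of [i]. *)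
Lemma minimally_intersectingP n (p p' : {set {set 'I_n}}) :
  set_partition p -> set_partition p' ->
  reflect (forall i j, j \in pblock p i -> j \in pblock p' i -> j = i)
    (minimally_intersecting p p').
Proof.
move=> hp hp'; have tp := partition_trivIset hp; have tp' := partition_trivIset hp'.
apply: (iffP eqP) => [eq_meet i j pj p'j|h].
  have [[pB Bi] [pB' Bi']] := (mem_pblockT i hp, mem_pblockT i hp').
  have : pblock p i :&: pblock p' i \in [set [set k] | k : 'I_n].
    rewrite -eq_meet !inE imset2_f // andbT.
    by apply/set0Pn; exists i; rewrite inE Bi.
  case/imsetP=> k _ /setP eq_k.
  have := eq_k i; have := eq_k j; rewrite !inE pj p'j Bi Bi' /=.
  by move=> /esym/eqP-> /esym/eqP->.
apply/setP => X; rewrite !inE; apply/andP/imsetP.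
  case=> /set0Pn[i Xi] /imset2P[B B' pB p'B' eqX]; exists i => //.
  move: Xi; rewrite eqX inE => /andP[Bi B'i].
  rewrite -(def_pblock tp pB Bi) -(def_pblock tp' p'B' B'i).
  have [[_ Bi'] [_ B'i']] := (mem_pblockT i hp, mem_pblockT i hp').
  apply/setP => j; rewrite !inE; apply/andP/eqP => [[]|->//].
  exact: h.
case=> i _ ->; have [[pB Bi] [pB' Bi']] := (mem_pblockT i hp, mem_pblockT i hp').
split; first by apply/set0Pn; exists i; rewrite inE.
apply/imset2P; exists (pblock p i) (pblock p' i) => //.
apply/setP => j; rewrite !inE; apply/eqP/andP => [->//|[]].
by move=> pj p'j; apply: h.
Qed.

(** * Colourings and pairs of partitions *)

Section Pairs.
Variable m : nat.
Local Notation n := m.+1.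
Implicit Types (i j k : 'I_n) (x y : data n) (c : 'I_n -> bool).

(** Blocks correspond to the colours in use, and [ord0] already uses [false]. *)
Lemma card_colour_partition (p : {set {set 'I_n}}) c : set_partition p ->
  (forall i j, (j \in pblock p i) = (c i == c j)) -> c ord0 = false ->
  (#|p| == 2) = [exists i, c i].
Proof.
move=> hp pc c0; pose g d : {set 'I_n} := [set j | d == c j].
have -> : p = g @: (c @: [set: 'I_n]).
  rewrite -imset_comp -(equivalence_partition_pblock hp).
  by apply: eq_imset => i; apply/setP => j; rewrite !inE pc.
rewrite card_in_imset; last first.
  move=> d d' /imsetP[i _ ->] _ /setP/(_ i); rewrite !inE eqxx.
  by move=> /esym/eqP.
case: existsP => [[i ci]|no_c].
  rewrite (_ : c @: _ = setT) ?cardsT ?card_bool //.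
  by apply/setP => -[]; rewrite inE; apply/imsetP; [exists i | exists ord0].
rewrite (_ : c @: _ = [set false]) ?cards1 //.
apply/setP => d; rewrite inE; apply/imsetP/eqP => [[i _ ->]|->].
  by apply/negbTE/negP => ci; apply: no_c; exists i.
by exists ord0.
Qed.

(* The colour is constant on the blocks of p; as p is unordered, it is
   normalised to vanish at the first point. The parity condition gives back the
   bit x.2 ord0 that this normalisation forgets. *)
Definition colour x i : bool :=
  x.2 i (+) (i != orbit_min x i) (+) ((orbit_min x i == ord0) && x.2 ord0).

Lemma orbit_min_ord0 x : orbit_min x ord0 = ord0. Proof. by []. Qed.

Lemma orbit_min_eq0 x i : i <= x.1 i -> (orbit_min x i == ord0) = (i == ord0).
Proof. by rewrite /orbit_min => ->. Qed.

Lemma orbit_min_step x i :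
  involutive x.1 -> orbit_min x (x.1 i) = orbit_min x i.
Proof. by move=> inv; apply/eqP; rewrite eq_sym orbit_min_eq // eqxx orbT. Qed.

Lemma colour_ord0 x : colour x ord0 = false.
Proof. by rewrite /colour orbit_min_ord0 eqxx /=; case: (x.2 _). Qed.

(** Exactly one of [i] and [x.1 i] is least in the orbit; the other two terms of [colour] are
    constant on it. *)
Lemma colour_step x i : symmetric_data x -> x.1 i != i ->
  colour x (x.1 i) = ~~ colour x i.
Proof.
case/symmetric_dataP=> inv x2 ni; rewrite /colour orbit_min_step // x2.
have -> : (x.1 i != orbit_min x i) = ~~ (i != orbit_min x i).
  rewrite /orbit_min; case: ifP => _; rewrite ?eqxx ?ni //.
  by rewrite eq_sym ni.
by rewrite addbN addNb.
Qed.

(** At the least element of an orbit the colour is the bit, except at [ord0], where the colour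
    vanishes. Hence even weight determines [x.2 ord0] from the involution and the colours. *)
Lemma odd_weight x : odd (weight x) =
  x.2 ord0 (+) odd #|[set i : 'I_n | (i <= x.1 i) && colour x i]|.
Proof.
rewrite /weight (cardsD1 ord0) inE leq0n oddD oddb; congr (_ (+) odd _).
apply: eq_card => i; rewrite !inE; case: (eqVneq i ord0) => [->|ni] /=.
  by rewrite colour_ord0.
case: leqP => //= le_i.
by rewrite /colour orbit_min_eq0 // (negbTE ni) /orbit_min le_i eqxx !addbF.
Qed.

Lemma colour_inj x y : even_data x -> even_data y -> x.1 = y.1 ->
  colour x =1 colour y -> x = y.
Proof.
move=> /andP[sx ex] /andP[sy ey] eq1 eqc.
have eq_min i : orbit_min x i = orbit_min y i by rewrite /orbit_min eq1.
have eq0 : x.2 ord0 = y.2 ord0.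
  move: ex ey; rewrite !odd_weight eq1.
  rewrite (eq_card (B := [set i : 'I_n | (i <= y.1 i) && colour y i])); last first.
    by move=> i; rewrite !inE eqc.
  by case: (x.2 _); case: (y.2 _); case: (odd _).
case: x y eq1 eqc eq_min eq0 {sx ex sy ey} => [s b] [s' b'] /= -> eqc eq_min eq0.
congr (_, _); apply/ffunP => i; have := eqc i.
by rewrite /colour eq_min /= eq0 => /addIb/addIb.
Qed.

Lemma data_of_colour (s : {ffun 'I_n -> 'I_n}) c :
  involutive s -> c ord0 = false -> (forall i, s i != i -> c (s i) = ~~ c i) ->
  exists2 x, even_data x & x.1 = s /\ colour x =1 c.
Proof.
move=> inv c0 cs.
(* The bits here are dummies: [orbit_min] sees only the involution. *)
pose r := orbit_min (s, [ffun=> false]).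
(* [K] is the bit that [ord0] must carry for the weight to be even. *)
pose K := odd #|[set i : 'I_n | (i <= s i) && c i]|.
pose x : data n := (s, [ffun i => c (r i) (+) ((r i == ord0) && K)]).
have rE i : orbit_min x i = r i by [].
have r0 : r ord0 = ord0 by [].
have x20 : x.2 ord0 = K by rewrite ffunE r0 c0.
have cx : colour x =1 c.
  move=> i; rewrite /colour rE x20 ffunE addbAC addbK.
  rewrite /r /orbit_min /=; case: ifP => [_|lt_i]; first by rewrite eqxx addbF.
  have ni : s i != i by apply: contraFneq lt_i => ->.
  by rewrite cs // eq_sym ni addbT negbK.
have sx : symmetric_data x.
  by apply/symmetric_dataP; split=> // i; rewrite !ffunE -!rE orbit_min_step.
exists x => //; rewrite /even_data sx odd_weight x20.
rewrite (eq_card (B := [set i : 'I_n | (i <= s i) && c i])) ?addbb //.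
by move=> i; rewrite !inE cx.
Qed.

(** Every moved point or its image is coloured, so without colours the involution is the identity
    and [colour_inj] applies. Thus the excluded clan matches the case of a one-block [p]. *)
Lemma data0_colour x : even_data x -> (x != data0 n) = [exists i, colour x i].
Proof.
move=> ex; have /andP[sx _] := ex; have [inv _] := symmetric_dataP _ sx.
apply/idP/idP => [|/existsP[i ci]].
  apply: contraNT; rewrite negb_exists => /forallP no_c.
  have c0 i : colour x i = false by apply/negbTE.
  have x1 i : x.1 i = i.
    by apply/eqP/negPn/negP => /(colour_step sx); rewrite !c0.
  apply/eqP/colour_inj => //; first exact: data0_even.
    by apply/ffunP => i; rewrite x1 ffunE.
  by move=> i; rewrite c0 /colour /orbit_min !ffunE leqnn eqxx andbF.
apply: contraTneq ci => ->.
by rewrite /colour /orbit_min !ffunE leqnn eqxx andbF.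
Qed.

Definition linked x (pp : {set {set 'I_n}} * {set {set 'I_n}}) : bool :=
  [forall i, forall j, ((j \in pblock pp.1 i) == (colour x i == colour x j)) &&
    ((j \in pblock pp.2 i) == (j == i) || (j == x.1 i))].

Lemma linkedP x pp :
  reflect ((forall i j, (j \in pblock pp.1 i) = (colour x i == colour x j)) /\
           (forall i j, (j \in pblock pp.2 i) = (j == i) || (j == x.1 i)))
    (linked x pp).
Proof.
apply: (iffP idP) => [h|[h1 h2]].
  have h' i j := andP (forallP (forallP h i) j).
  by split=> i j; have [/eqP h1 /eqP h2] := h' i j.
by apply/forallP => i; apply/forallP => j; rewrite h1 h2 !eqxx.
Qed.

Lemma data_linked x : even_data x -> x != data0 n ->
  exists2 pp, admissible_pair pp & linked x pp.
Proof.
move=> ex; rewrite data0_colour // => xc; have /andP[sx _] := ex.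
have [inv x2] := symmetric_dataP _ sx.
pose p := preim_partition (colour x) [set: 'I_n].
pose p' := preim_partition (orbit_min x) [set: 'I_n].
have hp : set_partition p by apply: preim_partitionP.
have hp' : set_partition p' by apply: preim_partitionP.
exists (p, p').
  rewrite /admissible_pair /= hp hp' (card_colour_partition (c := colour x)) ?xc //.
  - rewrite andbT; apply/minimally_intersectingP => // i j.
    rewrite !pblock_preim orbit_min_eq // => eq_c /orP[/eqP//|/eqP eq_j].
    apply/eqP/negPn/negP; rewrite eq_j => /(colour_step sx).
    by move/eqP: eq_c; rewrite eq_j => ->; case: (colour _ _).
  - by move=> i j; rewrite pblock_preim.
  - exact: colour_ord0.
apply/linkedP; split=> i j; rewrite pblock_preim //.
exact: orbit_min_eq.
Qed.

Lemma pair_linked pp : admissible_pair pp ->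
  exists2 x, even_data x && (x != data0 n) & linked x pp.
Proof.
case: pp => p p' /and4P[/= hp hp' /(minimally_intersectingP hp hp') meet card_p].
(* The colour marks the block of [p] that avoids the first point. *)
pose c i := i \notin pblock p ord0.
have tp := partition_trivIset hp; have tp' := partition_trivIset hp'.
have c0 : c ord0 = false by rewrite /c (mem_pblockT ord0 hp).2.
have pc i j : (j \in pblock p i) = (c i == c j).
  have in_p k : pblock p k \in p := (mem_pblockT k hp).1.
  have covT k : k \in cover p by rewrite -mem_pblock (mem_pblockT k hp).2.
  rewrite -eq_pblock // /c -!eq_pblock //.
  have /cards2P[A [B [neq_AB defp]]] := card_p.
  have := in_p i; have := in_p j; have := in_p ord0; rewrite defp !inE.
  have AB := negbTE neq_AB; have BA : (B == A) = false by rewrite eq_sym.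
  by move=> /orP[]/eqP-> /orP[]/eqP-> /orP[]/eqP->; rewrite ?eqxx ?AB ?BA.
have sym' i j : (j \in pblock p' i) = (i \in pblock p' j).
  by rewrite -!eq_pblock // 1?eq_sym // -mem_pblock (mem_pblockT _ hp').2.
have ne_c a b : b \in pblock p' a -> b != a -> c b = ~~ c a.
  move=> ab nba; apply/eqP; apply: contraNT nba => eq_c; apply/eqP/meet => //.
  by rewrite pc; case: (c a) (c b) eq_c => [] [].
pose spec i u := forall k, (k \in pblock p' i) = (k == i) || (k == u).
have [s hs] : exists s : 'I_n -> 'I_n, forall i, spec i (s i).
  apply: fin_all_exists => i; rewrite /spec.
  have ii : i \in pblock p' i := (mem_pblockT i hp').2.
  case: (pickP [pred j | (j \in pblock p' i) && (j != i)]) => [j /andP[ij ni]|no_j].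
    exists j => k; apply/idP/orP => [ik|[]/eqP->//].
    have jk : k \in pblock p' j by rewrite (same_pblock tp' ij).
    case: (eqVneq k i) => [|nki]; [by left | right].
    apply/negPn/negP => nkj.
    (* Otherwise [i], [j] and [k] would have pairwise different colours, but there are only two. *)
    by have := ne_c _ _ jk nkj; rewrite (ne_c _ _ ik nki) (ne_c _ _ ij ni); case: (c i).
  exists i => k; rewrite orbb; apply/idP/eqP => [ik|->//].
  by have := no_j k; rewrite /= ik => /negbFE/eqP.
have inv : involutive s.
  move=> i; have := hs (s i) i; rewrite sym' hs eqxx orbT.
  by case/esym/orP=> /eqP e; rewrite -!e.
have cs i : s i != i -> c (s i) = ~~ c i.
  by apply: ne_c; rewrite hs eqxx orbT.
have [||x ex [x1 cx]] := @data_of_colour (finfun s) c _ c0.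
- by move=> i; rewrite !ffunE.
- by move=> i; rewrite ffunE; apply: cs.
exists x.
  rewrite ex data0_colour // (eq_existsb cx).
  by rewrite -(card_colour_partition hp pc c0).
apply/linkedP; split=> i j; first by rewrite !cx pc.
by rewrite hs x1 ffunE.
Qed.

End Pairs.

(** * The two bijections and their composite *)

Lemma exists_bij_data_pairs m :
  exists f : {x : data m.+1 | even_data x && (x != data0 m.+1)} ->
             {pp : {set {set 'I_m.+1}} * {set {set 'I_m.+1}} | admissible_pair pp},
    bijective f.
Proof.
apply: (@bijective_of_rel _ _ (fun x pp => linked (val x) (val pp))).
- case=> x /= /[dup] px /andP[ex nx].
  by have [pp hpp xpp] := data_linked ex nx; exists (exist _ pp hpp).
- case=> pp hpp; have [x px xpp] := pair_linked hpp.
  by exists (exist _ x px).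
- case=> x px [pp hpp] [qq hqq] /= /linkedP[p1 p2] /linkedP[q1 q2].
  apply: val_inj => /=; have /and4P[hp hp' _ _] := hpp.
  have /and4P[hq hq' _ _] := hqq.
  case: pp qq {hpp hqq} p1 p2 q1 q2 hp hp' hq hq' => p p' [q q'] /=.
  move=> p1 p2 q1 q2 hp hp' hq hq'.
  by congr (_, _); apply: set_partition_ext => // i j; rewrite ?p1 ?q1 ?p2 ?q2.
case=> x px [y py] [pp hpp] /= /linkedP[x1 x2] /linkedP[y1 y2].
apply: val_inj => /=; have [/andP[ex _] /andP[ey _]] := (px, py).
apply: colour_inj => //.
  apply/ffunP => i; have := x2 i (x.1 i); rewrite y2 eqxx orbT.
  have := y2 i (y.1 i); rewrite x2 eqxx orbT.
  by move=> /orP[]/eqP-> // /orP[]/eqP.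
(* Comparison with the first point, which has colour [false] for both data, turns equal blocks into
   equal colours. *)
move=> i; have := x1 ord0 i; rewrite y1 !colour_ord0.
by case: (colour x i); case: (colour y i).
Qed.

Lemma exists_bij_clans_data n :
  exists f : {c : clan n | DIII c && (c != plus_minus_clan n)} ->
             {x : data n | even_data x && (x != data0 n)},
    bijective f.
Proof.
have eq_clan (c c' : clan n) :
    same_clan (val (repr c)) (val (repr c')) -> c = c'.
  by move=> cc; rewrite -[c]reprK -[c']reprK; apply/eqmodP.
have repr_pi (w : clan_word n) : same_clan (val (repr (\pi_(clan n)%qT w))) (val w).
  by have /eqmodP := reprK (\pi_(clan n)%qT w).
pose R (c : {c : clan n | DIII c && (c != plus_minus_clan n)})
  (x : {x : data n | even_data x && (x != data0 n)}) :=
  models (val (repr (val c))) (val x).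
apply: (@bijective_of_rel _ _ R); rewrite /R {R}.
- case=> c /= /andP[Dc nc].
  have [x ex cx] := DIII_models (valP (repr c)) Dc.
  suff px : even_data x && (x != data0 n) by exists (exist _ x px).
  (* If the datum is [data0], the clan has the same model as the excluded one. *)
  rewrite ex; apply: contra_neq nc => x0; apply: eq_clan.
  rewrite x0 in cx; apply: same_clan_trans (models_same_clan cx _) _.
    exact: plus_minus_models.
  by rewrite same_clan_sym; apply: repr_pi.
- case=> x /= /andP[ex nx]; have /andP[sx _] := ex.
  have mx := data_word_models sx.
  pose w : clan_word n := exist (fun s => is_clan s) (data_word x) (models_is_clan mx).
  suff pw : DIII (\pi_(clan n)%qT w) && (\pi_(clan n)%qT w != plus_minus_clan n).
    exists (exist (fun c => DIII c && (c != plus_minus_clan n)) _ pw) => /=.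
    by apply: same_clan_transfer (mx); rewrite same_clan_sym; apply: repr_pi.
  rewrite DIII_pi (models_is_DIII sx mx) ex.
  apply: contra_neq nx => /eqmodP eq_w.
  exact: same_clan_models eq_w mx (plus_minus_models n).
- case=> c pc [x px] [y py] /= cx cy; apply: val_inj => /=.
  exact: same_clan_models (same_clan_refl _) cx cy.
case=> c pc [c' pc'] [x px] /= cx cx'; apply: val_inj => /=.
exact/eq_clan/models_same_clan/cx'.
Qed.

Theorem theorem5p13 (n : nat) (hn : 1 <= n) :
  exists f : {c : clan n | DIII c && (c != plus_minus_clan n)} ->
             {pp : {set {set 'I_n}} * {set {set 'I_n}} | admissible_pair pp},
    bijective f.
Proof.
(* Writing [n] as a successor provides the first point [ord0] that normalises the colours. *)
case: n hn => // m _.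
have [f bij_f] := exists_bij_clans_data m.+1.
have [g bij_g] := exists_bij_data_pairs m.
by exists (g \o f); apply: bij_comp.
Qed.
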